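(* Let $T=(t_i)_{i\le n}$ be a finite sequence of points of $(\mathbb{Z}^+)^2$. Then $T$ is an Erdős–Szekeres tableau (i.e. $T=T(A)$ for some sequence $A$ of $n$ distinct real numbers) if and only if for each $1\le i\le n$ we have $t_i\in W(T_{i-1})$, where $T_{i-1}=(t_1,\dots,t_{i-1})$.
   Context: For a sequence $A=(a_1,\dots,a_n)$ of distinct real numbers, let $a_i^+$ (resp. $a_i^-$) be the length of the longest increasing (resp. decreasing) subsequence of $A$ ending at $a_i$. The Erdős–Szekeres tableau (EST) of $A$ is the sequence of points $T(A)=(t_i)_{i\le n}$ with $t_i=(a_i^+,a_i^-)$. For a sequence of points $T=(t_i)_{i\le n}$, $t_i=(x_i,y_i)$, the shadow is $S(T)=\bigcup_{i\le n}\big(\{(x,y_i): 1\le x\le x_i\}\cup\{(x_i,y): 1\le y\le y_i\}\big)$ (positive integer points), and the wall is $W(T)=\big(S(T)+\{(1,0),(0,1)\}\big)\setminus S(T)$ (where $S+\{(1,0),(0,1)\}=\{s+v: s\in S, v\in\{(1,0),(0,1)\}\}$) if $|T|>0$, and $W(T)=\{(1,1)\}$ if $T$ is empty. *)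

(* Defs.v *)
From mathcomp Require Import all_boot all_order all_algebra.
From mathcomp Require Import classical_sets reals.

Set Implicit Arguments.
Unset Strict Implicit.
Unset Printing Implicit Defensive.

Import Order.TTheory GRing.Theory Num.Theory.

Local Open Scope classical_set_scope.
Local Open Scope nat_scope.

Section Tableau.
Variables (R : realType) (n : nat).
Implicit Types (A : n.-tuple R) (i : 'I_n) (J : {set 'I_n}) (r : rel R).

(* A subsequence of A is given by its set J of indices. *)
Definition chain_ending_at r A i J : bool :=
  [&& i \in J,
      [forall j in J, j <= i] &
      [forall j in J, forall k in J, (j < k) ==> r (tnth A j) (tnth A k)]].

Definition longest_chain_at r A i : nat :=
  \max_(J : {set 'I_n} | chain_ending_at r A i J) #|J|.

Definition longest_incr_at A i : nat :=
  longest_chain_at [rel a b | (a < b)%R] A i.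

Definition longest_decr_at A i : nat :=
  longest_chain_at [rel a b | (b < a)%R] A i.

Definition EST A : n.-tuple (nat * nat) :=
  [tuple (longest_incr_at A i, longest_decr_at A i) | i < n].

End Tableau.

Definition is_EST (R : realType) (n : nat) (T : n.-tuple (nat * nat)) : Prop :=
  exists A : n.-tuple R, uniq A /\ T = EST A.

(* Points of (Z^+)^2 are pairs of naturals with both coordinates positive. *)
Definition pos_point (t : nat * nat) : bool := (0 < t.1) && (0 < t.2).

Definition shadow (T : seq (nat * nat)) : set (nat * nat) :=
  \bigcup_(t in [set t | t \in T])
    ([set (x, t.2) | x in [set x | 1 <= x <= t.1]] `|`
     [set (t.1, y) | y in [set y | 1 <= y <= t.2]]).

Definition sumset (S V : set (nat * nat)) : set (nat * nat) :=
  [set (s.1 + v.1, s.2 + v.2) | s in S & v in V].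

Definition wall (T : seq (nat * nat)) : set (nat * nat) :=
  if T is [::] then [set (1, 1)]
  else sumset (shadow T) [set (1, 0); (0, 1)] `\` shadow T.

(* Main.v *)
Require Import Defs.
From mathcomp Require Import all_boot all_order all_algebra.
From mathcomp Require Import classical_sets reals.
From mathcomp Require Import zify lra.

(** Write t_i = (x_i, y_i). An index set realizing x_i is a chain at an earlier
    k with a_k < a_i, extended by i, so x_i is 1 plus the maximum of x_k over
    such k; y_i is treated alike. Hence a_j < a_k forces x_j < x_k (if j comes
    first) or y_k < y_j (if k does). Together with the fact that every smaller
    height is attained along a longest chain, this dichotomy shows that the
    shadow of a tableau is a down-set and that t_i lies on the wall of the
    earlier points.
    Conversely, let (p, q) lie on the wall of the tableau of a. Some a_i has
    x_i = p - 1 and y_i >= q, or y_i = q - 1 and x_i >= p. In the first case the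
    new number is inserted just above the largest a_m with y_m >= q; the second
    case is the first one for -a with the coordinates exchanged. *)

Set Implicit Arguments.
Unset Strict Implicit.
Unset Printing Implicit Defensive.

Import Order.TTheory GRing.Theory Num.Theory.

Lemma bigmax_succ_eq (n : nat) (P : pred nat) (F : nat -> nat) (p : nat) :
  0 < p -> (forall j, j < n -> P j -> F j < p) ->
  (1 < p -> exists j, [/\ j < n, P j & (F j).+1 = p]) ->
  p = (\max_(j < n | P j) F j).+1.
Proof.
move=> p0 ub att; apply/eqP; rewrite eqn_leq; apply/andP; split; last first.
  rewrite -(ltn_predK p0) ltnS; apply/bigmax_leqP => j Pj.
  by have := ub j (ltn_ord j) Pj; lia.
have [/att[j [jn Pj <-]]|] := ltnP 1 p; last by lia.
by rewrite ltnS; exact: (leq_bigmax_cond (Ordinal jn)).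
Qed.

(** * Chain lengths as recursively determined heights *)

Section Heights.
Variable R : realType.
Implicit Types (a : nat -> R) (h x y : nat -> nat) (r : rel R) (n : nat).

(** For transitive [r], this recursion characterizes the length of a longest [r]-chain ending at
    [i]. Values and heights are functions on [nat], so that a sequence can grow without a change of
    type. *)
Definition is_height r n a h :=
  forall i, i < n -> h i = (\max_(j < i | r (a j) (a i)) h j).+1.

Lemma eq_is_height r n a a' h : {in gtn n, a =1 a'} ->
  is_height r n a h -> is_height r n a' h.
Proof.
move=> eqa hh i ltin; rewrite hh //; congr _.+1; apply: eq_bigl => j.
by rewrite !eqa // inE; exact: ltn_trans (ltn_ord j) ltin.
Qed.

Lemma is_height_lt r n a h j i : is_height r n a h ->
  j < i -> i < n -> r (a j) (a i) -> h j < h i.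
Proof.
move=> hh ltji ltin raji; rewrite (hh i ltin) ltnS.
exact: (leq_bigmax_cond (Ordinal ltji)).
Qed.

(** The maximum in the recursion is attained at a predecessor of height [h i - 1]. If that still
    exceeds [p], descend from there; transitivity links the index found back to [i]. *)
Lemma is_height_attained r n a h i p : transitive r -> is_height r n a h ->
  i < n -> 0 < p < h i -> exists j, [/\ j < i, r (a j) (a i) & h j = p].
Proof.
move=> tr hh; elim/ltn_ind: i p => i IH p ltin /andP[p0].
rewrite hh // ltnS => lep.
have [ |j raji maxj] := @eq_bigmax_cond _ (fun j : 'I_i => r (a j) (a i)) (h \o val).
  rewrite lt0n; apply/eqP => /card0_eq P0; move: lep.
  by rewrite big_pred0; [lia|exact: P0].
move: lep; rewrite maxj /= leq_eqVlt => /orP[/eqP ->|ltp]; first by exists j.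
have [||k [ltkj rakj hk]] := IH j (ltn_ord j) p; [exact: ltn_trans ltin|lia|].
by exists k; split=> //; [exact: ltn_trans (ltn_ord j)|exact: tr raji].
Qed.

Lemma is_height_uniq r n a h h' :
  is_height r n a h -> is_height r n a h' -> {in gtn n, h =1 h'}.
Proof.
move=> hh hh'; elim/ltn_ind=> i IH; rewrite inE => ltin.
rewrite hh // hh' //; congr _.+1; apply: eq_bigr => j _.
by apply: IH => //; rewrite inE; exact: ltn_trans ltin.
Qed.

Lemma longest_chain_rec r n (A : n.-tuple R) (i : 'I_n) : transitive r ->
  longest_chain_at r A i =
  (\max_(j < n | r (tnth A j) (tnth A i) && (j < i)) longest_chain_at r A j).+1.
Proof.
move=> tr.
have chain1 k : chain_ending_at r A k [set k].
  apply/and3P; split; first by rewrite inE.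
    by apply/forall_inP => j /set1P ->.
  by apply/forall_inP => j /set1P ->; apply/forall_inP => l /set1P ->; rewrite ltnn.
apply/eqP; rewrite eqn_leq; apply/andP; split.
  (* Upper bound: deleting [i] from a chain leaves nothing or a chain ending at its largest index
     [k]. *)
  apply/bigmax_leqP => J /and3P[iJ /forall_inP Jle /forall_inP Jr].
  rewrite (cardsD1 i) iJ add1n ltnS.
  have [->|[k0 k0J]] := set_0Vmem (J :\ i); first by rewrite cards0.
  case: (arg_maxnP val k0J) => k kJ kmax.
  have /setD1P[ki kJ'] : k \in J :\ i := kJ.
  have ltki : k < i by rewrite ltn_neqAle ki Jle.
  have chk : chain_ending_at r A k (J :\ i).
    apply/and3P; split=> //.
      by apply/forall_inP => j jJ; exact: kmax.
    apply/forall_inP => j; rewrite inE => /andP[_ jJ].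
    apply/forall_inP => l; rewrite inE => /andP[_ lJ].
    exact: (forall_inP (Jr j jJ)).
  have rki : r (tnth A k) (tnth A i).
    by have /forall_inP/(_ i iJ)/implyP := Jr k kJ'; exact.
  apply: leq_trans (leq_bigmax_cond (F := fun J : {set 'I_n} => #|J|) _ chk) _.
  by apply: (leq_bigmax_cond (F := longest_chain_at r A) k); rewrite rki.
(* Lower bound: adjoin [i] to a longest chain ending at the best predecessor [k], or take the
   singleton of [i] if there is no predecessor. *)
have [/eqP P0|Pn0] := posnP #|[pred j : 'I_n | r (tnth A j) (tnth A i) && (j < i)]|.
  rewrite big_pred0; last by apply/card0_eq/eqP.
  apply: leq_trans (leq_bigmax_cond (F := fun J : {set 'I_n} => #|J|) _ (chain1 i)).
  by rewrite cards1.
have [k /andP[rki ltki] ->] := eq_bigmax_cond (longest_chain_at r A) Pn0.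
have [J chJ ->] : exists2 J, chain_ending_at r A k J & longest_chain_at r A k = #|J|.
  have [|J chJ hJ] := @eq_bigmax_cond _ (chain_ending_at r A k) (fun J => #|J|);
    last by exists J.
  by apply/card_gt0P; exists [set k]; rewrite unfold_in; exact: chain1.
have /and3P[kJ /forall_inP Jle /forall_inP Jr] := chJ.
have iJ : i \notin J by apply/negP => /Jle; rewrite leqNgt ltki.
have ch' : chain_ending_at r A i (i |: J).
  apply/and3P; split; first by rewrite !inE eqxx.
    apply/forall_inP => j /setU1P[-> //|jJ].
    by apply: ltnW; apply: leq_ltn_trans ltki; exact: Jle.
  have rJi j : j \in J -> r (tnth A j) (tnth A i).
    move=> jJ; have := Jle j jJ; rewrite leq_eqVlt => /orP[/eqP/val_inj -> //|ltjk].
    by apply: tr rki; have /forall_inP/(_ k kJ)/implyP := Jr j jJ; exact.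
  apply/forall_inP => j jJ; apply/forall_inP => l lJ; apply/implyP => ltjl.
  case/setU1P: jJ lJ ltjl => [->|jJ] /setU1P[->|lJ].
  - by rewrite ltnn.
  - by have := Jle l lJ; lia.
  - by move=> _; exact: rJi.
  - by have /forall_inP/(_ l lJ)/implyP := Jr j jJ; exact.
apply: leq_trans (leq_bigmax_cond (F := fun J : {set 'I_n} => #|J|) _ ch').
by rewrite cardsU1 iJ.
Qed.

Lemma is_height_longest_chain r n (A : n.-tuple R) a h : transitive r ->
  (forall i : 'I_n, tnth A i = a i) ->
  (forall i : 'I_n, longest_chain_at r A i = h i) <-> is_height r n a h.
Proof.
move=> tr Aa.
have rec h' : (forall i : 'I_n, longest_chain_at r A i = h' i) -> is_height r n a h'.
  move=> hE i ltin; rewrite -(hE (Ordinal ltin)) longest_chain_rec // (big_ord_narrow_cond (ltnW ltin)).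
  congr _.+1; apply: eq_big => [j|j _]; first by rewrite !Aa.
  by rewrite hE.
split=> [|hh i]; first exact: rec.
(* Uniqueness of heights compares functions on [nat], so the chain lengths are extended by 0 from
   [n] on. *)
pose h' k := if insub k is Some j then longest_chain_at r A j else 0.
have h'E j : longest_chain_at r A j = h' j by rewrite /h' valK.
by rewrite h'E; apply: (is_height_uniq (rec _ h'E) hh); rewrite inE.
Qed.

(** * Tableaux, their shadows and their walls *)

Definition tableau n a x y :=
  [/\ {in gtn n &, injective a}, is_height <%R n a x & is_height >%R n a y].

Lemma tableau_opp n a x y : tableau n a x y -> tableau n (fun k => - a k)%R y x.
Proof.
case=> inja hx hy; split.
- by move=> i j ilt jlt /oppr_inj; exact: inja.
- by move=> i ltin; rewrite hy //; congr _.+1; apply: eq_bigl => j /=; rewrite ltrN2.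
- by move=> i ltin; rewrite hx //; congr _.+1; apply: eq_bigl => j /=; rewrite ltrN2.
Qed.

Lemma tableau_lt n a x y j k : tableau n a x y -> j < n -> k < n ->
  (a j < a k)%R -> x j < x k \/ y k < y j.
Proof.
case=> _ hx hy ltjn ltkn ajk; case: (ltngtP j k) => [ltjk|ltkj|ejk].
- by left; exact: is_height_lt hx _ _ _.
- by right; exact: is_height_lt hy _ _ _.
- by move: ajk; rewrite ejk ltxx.
Qed.

Lemma tableau_attained_below n a x y i p : tableau n a x y -> i < n ->
  0 < p < x i -> exists j, [/\ j < i, (a j < a i)%R & x j = p].
Proof. by case=> _ hx _; apply: is_height_attained hx; exact: lt_trans. Qed.

Lemma tableau_attained_above n a x y i q : tableau n a x y -> i < n ->
  0 < q < y i -> exists j, [/\ j < i, (a i < a j)%R & y j = q].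
Proof. by case=> _ _ hy; apply: is_height_attained hy; exact: rev_trans lt_trans. Qed.

Definition shadowed n x y (p q : nat) :=
  exists2 j, j < n &
    (y j = q /\ 0 < p <= x j) \/ (x j = p /\ 0 < q <= y j).

(** Off the two segments of point [i] itself, pick [j] with [a j < a i], [x j = p] and [k] with
    [a i < a k], [y k = q]. As [a j < a k], either [x j < x k] and the row of [k] covers [(p, q)],
    or [y k < y j] and the column of [j] does. *)
Lemma shadowed_downset n a x y i p q : tableau n a x y -> i < n ->
  0 < p <= x i -> 0 < q <= y i -> shadowed n x y p q.
Proof.
move=> tab ltin px qy.
have [xp|xp] := eqVneq (x i) p; first by exists i => //; right.
have [yq|yq] := eqVneq (y i) q; first by exists i => //; left.
have [|j [ltji aji xj]] := @tableau_attained_below n a x y i p tab ltin; first by lia.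
have [|k [ltki aik yk]] := @tableau_attained_above n a x y i q tab ltin; first by lia.
have ltjn := ltn_trans ltji ltin; have ltkn := ltn_trans ltki ltin.
have [xjk|ykj] := tableau_lt tab ltjn ltkn (lt_trans aji aik).
  by exists k => //; left; lia.
by exists j => //; right; lia.
Qed.

(** The wall of the first [n] points, with the unit steps undone by predecessors; truncation at 0 is
    harmless for positive [p] and [q]. *)
Definition on_wall n x y (p q : nat) :=
  ~ shadowed n x y p q /\
  (n = 0 /\ p = 1 /\ q = 1 \/
   0 < n /\ (shadowed n x y p.-1 q \/ shadowed n x y p q.-1)).

Lemma tableau_on_wall n a x y i : tableau n a x y -> i < n ->
  on_wall i x y (x i) (y i).
Proof.
move=> tab ltin; case: (tab) => inja hx hy.
have x0 j : j < n -> 0 < x j by move/hx ->.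
have y0 j : j < n -> 0 < y j by move/hy ->.
have ltn j : j < i -> j < n by move=> ltji; exact: ltn_trans ltin.
(* A point [j] shadowing [(x i, y i)] would have both coordinates at least as large, but comparing
   [a j] with [a i] makes one of them strictly smaller. *)
split=> [[j ltji xyj]|].
  have [aji|aij|eaij] := ltgtP (a j) (a i).
  - by have := is_height_lt hx ltji ltin aji; lia.
  - by have := is_height_lt hy ltji ltin aij; lia.
  - have : j = i by apply: inja => //; rewrite inE; exact: ltn.
    lia.
have [i0|igt0] := posnP i.
  by left; split=> //; rewrite hx ?hy // i0 !big_ord0.
right; split=> //; have [x1|xle1] := ltnP 1 (x i); last first.
  (* Now [x i = 1]. Then [y i] exceeds 1, since comparison with [a 0] forces one coordinate of point
     [i] above 1. *)
  have [y1|yle1] := ltnP 1 (y i); last first.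
    have [a0i|ai0|eai] := ltgtP (a 0) (a i).
    - by have := is_height_lt hx igt0 ltin a0i; have := x0 0 (ltn _ igt0); lia.
    - by have := is_height_lt hy igt0 ltin ai0; have := y0 0 (ltn _ igt0); lia.
    - by have : 0 = i; [apply: inja => //; exact: ltn|lia].
  have [|k [ltki aik yk]] := @tableau_attained_above n a x y i (y i).-1 tab ltin; first by lia.
  by right; exists k => //; left; have := x0 k (ltn _ ltki); have := x0 i ltin; lia.
have [|j [ltji aji xj]] := @tableau_attained_below n a x y i (x i).-1 tab ltin; first by lia.
have := y0 j (ltn _ ltji); have := y0 i ltin => yi0 yj0.
have [yij|yji] := leqP (y i) (y j); first by left; exists j => //; right; lia.
have [|k [ltki aik yk]] := @tableau_attained_above n a x y i (y i).-1 tab ltin; first by lia.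
(* If [x j < x k], then [x k] is at least [x i] and point [k] shadows the lower neighbour;
   [y k < y j] contradicts [y j < y i = y k + 1]. *)
have [xjk|ykj] := tableau_lt tab (ltn _ ltji) (ltn _ ltki) (lt_trans aji aik).
  by right; exists k => //; left; lia.
by lia.
Qed.

(** * Inserting a value that realizes a given wall point *)

Lemma exists_just_above n a (u : R) :
  exists2 v, (u < v)%R & forall j, j < n -> (u < a j)%R -> (v < a j)%R.
Proof.
elim: n => [|n [v uv vP]]; first by exists (u + 1)%R; [lra|].
have [uan|anu] := ltP u (a n).
  exists (Num.min v ((u + a n) / 2))%R; first by rewrite lt_min uv; lra.
  move=> j; rewrite ltnS leq_eqVlt => /orP[/eqP -> _|ltjn uaj].
    by rewrite gt_min; apply/orP; right; lra.
  by rewrite gt_min vP.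
exists v => // j; rewrite ltnS leq_eqVlt => /orP[/eqP ->|]; last exact: vP.
by rewrite ltNge anu.
Qed.

Lemma tableau_insert n a x y p q : tableau n a x y -> 0 < q ->
  (forall j, j < n -> q <= y j -> x j < p) ->
  (exists i, [/\ i < n, (x i).+1 = p & q <= y i]) ->
  exists v, [/\ forall j, j < n -> a j != v,
    p = (\max_(j < n | (a j < v)%R) x j).+1 &
    q = (\max_(j < n | (v < a j)%R) y j).+1].
Proof.
move=> tab q0 noNE [i [ltin xi qyi]].
have [m qym mmax] := @arg_maxP _ _ _ (Ordinal ltin) (fun j => q <= y j) (fun j : 'I_n => a j) qyi.
have [v amv vP] := exists_just_above n a (a m).
have below j : j < n -> (a j < v)%R -> (a j <= a m)%R.
  by move=> ltjn; apply: contraTT; rewrite -ltNge -leNgt => /vP-/(_ ltjn)/ltW.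
have topm j : j < n -> q <= y j -> (a j <= a m)%R.
  by move=> ltjn; exact: (mmax (Ordinal ltjn)).
exists v; split.
- move=> j ltjn; have [/le_lt_trans/(_ amv)/lt_eqF ->//|amj] := leP (a j) (a m).
  by rewrite gt_eqF // vP.
(* For [a j < a m], either [x j < x m < p], or [y j > y m >= q] and the bound on [x] applies to [j]
   directly. The value [p - 1] is attained at [i], since [a i <= a m < v]. *)
- apply: (@bigmax_succ_eq n (fun j => (a j < v)%R)); first by rewrite -xi.
    move=> j ltjn /(below j ltjn); rewrite le_eqVlt => /orP[/eqP ajm|ajm].
      have [inja _ _] := tab; have -> : j = m by apply: inja ajm; rewrite inE.
      exact: noNE.
    have [xjm|ymj] := tableau_lt tab ltjn (ltn_ord m) ajm.
      exact: ltn_trans xjm (noNE m _ _).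
    by apply: noNE => //; exact: leq_trans (ltnW ymj).
  by move=> _; exists i; split=> //; exact: le_lt_trans (topm _ _ _) amv.
(* Maximality of [a m] bounds [y] above [v]; since [y m >= q], height [q - 1] occurs above [a m],
   hence above [v]. *)
- apply: (@bigmax_succ_eq n (fun j => (v < a j)%R)) => //.
    move=> j ltjn vaj; rewrite ltnNge; apply/negP => /(topm j ltjn).
    by rewrite leNgt (lt_trans amv vaj).
  move=> q1; have [|k [ltkm amk yk]] := @tableau_attained_above n a x y m q.-1 tab (ltn_ord m).
    by lia.
  have ltkn := ltn_trans ltkm (ltn_ord m).
  by exists k; split; [|exact: vP|lia].
Qed.

Lemma tableau_extend n a x y : tableau n a x y -> 0 < x n -> 0 < y n ->
  on_wall n x y (x n) (y n) ->
  exists v, [/\ forall j, j < n -> a j != v,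
    x n = (\max_(j < n | (a j < v)%R) x j).+1 &
    y n = (\max_(j < n | (v < a j)%R) y j).+1].
Proof.
move=> tab p0 q0 [nsh wl].
have noNE j : j < n -> x n <= x j -> y n <= y j -> False.
  by move=> ltjn xnj ynj; apply/nsh/(shadowed_downset tab ltjn); lia.
case: wl => [[n0 [-> ->]]|[_ [[j ltjn sh]|[j ltjn sh]]]].
- by exists 0%R; rewrite n0; split=> //; rewrite big_ord0.
- apply: tableau_insert => // [k ltkn ynk|].
    by rewrite ltnNge; apply/negP => xnk; exact: (noNE k).
  (* The shadowing [j] has [x j >= x n - 1] and [y j >= y n]; equality holds in the former because
     [j] cannot dominate the new point. *)
  exists j; case: (leqP (x n) (x j)) => [xnj|xjn].
    by case: (noNE j) => //; lia.
  by split=> //; lia.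
- have [|| v [av yE xE]] := @tableau_insert n _ y x (y n) (x n) (tableau_opp tab) p0.
  + move=> k ltkn xnk.
    by rewrite ltnNge; apply/negP => ynk; exact: (noNE k).
  + exists j; case: (leqP (y n) (y j)) => [ynj|yjn].
      by case: (noNE j) => //; lia.
    by split=> //; lia.
  exists (- v)%R; split.
  + by move=> k ltkn; rewrite -eqr_oppLR av.
  + by rewrite xE; congr _.+1; apply: eq_bigl => k; rewrite ltrNr.
  + by rewrite yE; congr _.+1; apply: eq_bigl => k; rewrite ltrNl.
Qed.

(** The values are built one at a time: heights look only at earlier indices, so a value placed at
    index [n] leaves the previous ones intact. *)
Lemma tableau_of_walls n x y : (forall i, i < n -> 0 < x i /\ 0 < y i) ->
  (forall i, i < n -> on_wall i x y (x i) (y i)) -> exists a, tableau n a x y.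
Proof.
elim: n => [|n IH] pos wl; first by exists (fun=> 0%R).
have [||a tab] := IH; [by move=> i /ltnW; exact: pos|by move=> i /ltnW; exact: wl|].
have [xn0 yn0] := pos n (ltnSn n).
have [v [av xE yE]] := tableau_extend tab xn0 yn0 (wl n (ltnSn n)).
pose b k := if k == n then v else a k.
have bn : b n = v by rewrite /b eqxx.
have ba j : j < n -> b j = a j by rewrite /b => /ltn_eqF ->.
have [inja hx hy] := tab.
have ab : {in gtn n, a =1 b} by move=> j; rewrite inE => /ba ->.
have hS r h : is_height r n a h ->
    h n = (\max_(j < n | r (a j) v) h j).+1 -> is_height r n.+1 b h.
  move=> hh hn i; rewrite ltnS leq_eqVlt => /orP[/eqP ->|]; last first.
    exact: eq_is_height hh i.
  by rewrite hn bn; congr _.+1; apply: eq_bigl => j; rewrite ba.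
exists b; split; [|exact: hS|exact: hS].
move=> i j; rewrite !inE !ltnS [i <= n]leq_eqVlt [j <= n]leq_eqVlt.
case/orP=> [/eqP ->|ltin] /orP[/eqP ->|ltjn] //; rewrite ?bn ?ba //.
- by move/eqP; rewrite eq_sym (negPf (av j ltjn)).
- by move/eqP; rewrite (negPf (av i ltin)).
- exact: inja.
Qed.

End Heights.

(** * Shadows and walls of prefixes, expressed by indices *)

Section Wall.
Variable T : seq (nat * nat).
Let x j := (nth (0, 0) T j).1.
Let y j := (nth (0, 0) T j).2.

Lemma shadow_take i p q : i <= size T ->
  shadow (take i T) (p, q) <-> shadowed i x y p q.
Proof.
move=> lei; split.
  case=> t /= /(nthP (0, 0))[j]; rewrite size_takel // => ltji.
  rewrite nth_take // => <- [[x' /= x'P [<- <-]]|[y' /= y'P [<- <-]]]; exists j => //.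
    by left.
  by right.
case=> j ltji sh; exists (nth (0, 0) T j).
  by rewrite /= -(nth_take (0, 0) ltji); apply: mem_nth; rewrite size_takel.
case: sh => [[<- pP]|[<- qP]]; [left; exists p|right; exists q] => //.
Qed.

Lemma wall_take i p q : i <= size T -> 0 < p -> 0 < q ->
  wall (take i T) (p, q) <-> on_wall i x y p q.
Proof.
move=> lei p0 q0; case: (posnP i) => [->|i0].
  rewrite take0 /wall /on_wall; split=> [[-> ->]|[_ [[_ [-> ->]]|[]]]] //.
  by split; [case|left].
have -> : wall (take i T) =
    (sumset (shadow (take i T)) [set (1, 0); (0, 1)] `\` shadow (take i T))%classic.
  by rewrite /wall; case: (take i T) (size_takel lei) i0 => // <-.
split.
  case=> [[[s1 s2] sh [v vP [<- <-]]]]; rewrite shadow_take // => nsh.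
  move/shadow_take: sh => /(_ lei) sh; split=> //; right; split=> //.
  case: vP => -> /=; [left|right]; by rewrite ?addn0 ?addn1.
case=> nsh [[iE0]|[_ sh]]; first by rewrite iE0 in i0.
split; last by rewrite shadow_take.
case: sh => sh.
  exists (p.-1, q); first exact/shadow_take.
  by exists (1, 0); [left|rewrite /= addn0 addn1 prednK].
exists (p, q.-1); first exact/shadow_take.
by exists (0, 1); [right|rewrite /= addn0 addn1 prednK].
Qed.

End Wall.

(** * From tuples of reals to tableaux, and the characterization by walls *)

Lemma is_EST_tableau (R : realType) (n : nat) (T : n.-tuple (nat * nat)) :
  is_EST R T <-> exists a : nat -> R,
    tableau n a (fun j => (nth (0, 0) T j).1) (fun j => (nth (0, 0) T j).2).
Proof.
have incP : transitive [rel a b : R | (a < b)%R] by move=> ? ? ?; exact: lt_trans.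
have decP : transitive [rel a b : R | (b < a)%R].
  by move=> b a c /= ba cb; exact: lt_trans cb ba.
split=> [[A [Auniq TE]]|[a [inja hx hy]]].
  have Aa i : tnth A i = nth 0%R A i by exact: tnth_nth.
  have Ti (i : 'I_n) : nth (0, 0) T i = (longest_incr_at A i, longest_decr_at A i).
    by rewrite -tnth_nth TE tnth_mktuple.
  exists (nth 0%R A); split.
  - by move=> i j; rewrite !inE => ilt jlt /eqP; rewrite nth_uniq ?size_tuple // => /eqP.
  - by apply/(is_height_longest_chain _ incP Aa) => i; rewrite Ti.
  - by apply/(is_height_longest_chain _ decP Aa) => i; rewrite Ti.
pose A := [tuple a i | i < n].
have Aa i : tnth A i = a i by rewrite tnth_mktuple.
exists A; split.
  rewrite map_inj_in_uniq ?enum_uniq // => i j _ _ /inja ij.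
  by apply/val_inj/ij; rewrite inE.
apply: eq_from_tnth => i; rewrite tnth_mktuple (tnth_nth (0, 0)).
have := (is_height_longest_chain _ incP Aa).2 hx i.
have := (is_height_longest_chain _ decP Aa).2 hy i.
by rewrite /longest_incr_at /longest_decr_at => -> ->; case: nth.
Qed.

(* Indices are 0-based: [take i T] is the sequence of the points before
   [tnth T i]. *)
Theorem theorem2 (R : realType) (n : nat) (T : n.-tuple (nat * nat))
    (hT : forall i : 'I_n, pos_point (tnth T i)) :
  is_EST R T <-> (forall i : 'I_n, wall (take i T) (tnth T i)).
Proof.
have Tpos i : i < n -> pos_point (nth (0, 0) T i).
  by move=> ltin; have := hT (Ordinal ltin); rewrite (tnth_nth (0, 0)).
have wallE (i : 'I_n) : wall (take i T) (tnth T i) <->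
    on_wall i (fun j => (nth (0, 0) T j).1) (fun j => (nth (0, 0) T j).2)
      (nth (0, 0) T i).1 (nth (0, 0) T i).2.
  have /andP[p0 q0] := Tpos i (ltn_ord i).
  rewrite -wall_take ?size_tuple ?(ltnW (ltn_ord i)) //.
  by rewrite (tnth_nth (0, 0)); case: nth.
rewrite is_EST_tableau; split=> [[a tab] i|wl].
  by apply/wallE; exact: tableau_on_wall tab (ltn_ord i).
apply: tableau_of_walls => i ltin; first exact/andP/Tpos.
exact/(wallE (Ordinal ltin)).
Qed.
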